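(* Let $F(z)={}_2F_1\left(\tfrac12,\tfrac12;1;z\right)$ and write $F(16x)^2=\sum_{n\ge0}A_nx^n$. Then: (a) $$A_n=\sum_{k=0}^n\binom{2k}{k}^2\binom{2n-2k}{n-k}^2,$$ so $(A_n)_{n\ge0}$ is the sequence OEIS A036917 (one of the six sporadic Almkvist–Zudilin sequences), and it satisfies $$n^3A_n=8(2n-1)(2n^2-2n+1)A_{n-1}-256(n-1)^3A_{n-2}\qquad(n\ge1).$$ (b) The generating function also admits the representation $$\sum_{n\ge0}A_nx^n={}_3F_2\left(\tfrac12,\tfrac12,\tfrac12;1,1;64x(1-16x)\right).$$ (c) If $c_n:=\dfrac{nA_n}{32^n}$, then $(c_n)$ is annihilated by the operator $$L_2^{(1)}=(n+1)^4-n(2n+3)(2n^2+6n+5)S+4n(n+1)(n+2)^2S^2,$$ equivalently $$(n+1)^4c_n-n(2n+3)(2n^2+6n+5)c_{n+1}+4n(n+1)(n+2)^2c_{n+2}=0.$$ In particular, the order-$3$ operator $$L_3^{(\pi,1)}=-\tfrac{(n+2)^4}{4}+\tfrac{5n^4+42n^3+130n^2+173n+81}{4}S-\tfrac{(n+1)(8n^3+62n^2+160n+137)}{4}S^2+(n+1)(n+2)(n+3)^2S^3$$ (the first order-$3$ recurrence for $\pi$ printed in Appendix B.6 of Raz et al.) is the summation lift of this $A036917$ kernel.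
   Context: All generating-function identities are identities of power series in $x$ around $0$; ${}_2F_1$ and ${}_3F_2$ are the usual hypergeometric series. The term with $A_{-1}$ in the recurrence at $n=1$ has coefficient $0$ and is omitted. $S$ denotes the forward shift on sequences, $(Sf)(n)=f(n+1)$, in the Ore algebra $\mathbb{Q}[n]\langle S\rangle$ with $S\,p(n)=p(n+1)S$; $\sigma$ is the automorphism $p(n)\mapsto p(n+1)$ applied to the coefficients of an operator. ''$L_3^{(\pi,1)}$ is the summation lift of $L_2^{(1)}$'' means $L_3^{(\pi,1)}=\frac14\,\sigma\bigl(L_2^{(1)}(S-1)\bigr)$; in particular if $(c_n)$ is annihilated by $L_2^{(1)}$ then the partial sums $s_n=\sum_{k=0}^nc_k$ are annihilated by $L_3^{(\pi,1)}$. *)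

(* Defs.v *)
From mathcomp Require Import all_boot all_order all_algebra.

Set Implicit Arguments.
Unset Strict Implicit.
Unset Printing Implicit Defensive.

Import Order.TTheory GRing.Theory Num.Theory.
Local Open Scope ring_scope.

(* A formal power series is represented by its sequence of coefficients. *)
Definition fps := nat -> rat.

Definition fps_mul (f g : fps) : fps :=
  fun n => \sum_(k < n.+1) f k * g (n - k)%N.

(* The series f(g(x)) for a polynomial g without constant term; it is only
   meaningful if g`_0 = 0, in which case (g ^+ k)`_n = 0 for all k > n, so that
   the truncation of the sum at k = n loses nothing. *)
Definition fps_comp (f : fps) (g : {poly rat}) : fps :=
  fun n => \sum_(k < n.+1) f k * (g ^+ k)`_n.

Definition pochhammer (a : rat) (n : nat) : rat := \prod_(i < n) (a + i%:R).

(* The generalized hypergeometric series pFq(a; b; z) in z. *)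
Definition hypergeometric (a b : seq rat) : fps :=
  fun n => (\prod_(u <- a) pochhammer u n) /
           ((\prod_(v <- b) pochhammer v n) * n`!%:R).

Definition F21 : fps := hypergeometric [:: 1 / 2; 1 / 2] [:: 1].

Definition F32 : fps := hypergeometric [:: 1 / 2; 1 / 2; 1 / 2] [:: 1; 1].

Definition A036917 (n : nat) : nat :=
  (\sum_(k < n.+1) 'C(2 * k, k) ^ 2 * 'C(2 * n - 2 * k, n - k) ^ 2)%N.

(* An element \sum_i p_i(n) S^i of the Ore algebra Q[n]<S>, with coefficients
   written on the left, is encoded as the polynomial in S with coefficients p_i.
   Addition and left scaling are those of {poly {poly rat}}, but the product of
   the Ore algebra is ore_mul, not the commutative product of polynomials. *)
Definition ore := {poly {poly rat}}.

Definition ore_n : {poly rat} := 'X.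

Definition ore_S : ore := 'X.

Definition shift_poly (p : {poly rat}) : {poly rat} := p \Po ('X + 1).

Definition ore_sigma (L : ore) : ore := map_poly shift_poly L.

(* Determined by bilinearity and S^i q(n) = q(n + i) S^i. *)
Definition ore_mul (L M : ore) : ore :=
  \sum_(i < size L) \sum_(j < size M)
     (L`_i * iter i shift_poly M`_j) *: 'X^(i + j).

Definition ore_act (L : ore) (f : nat -> rat) : nat -> rat :=
  fun n => \sum_(i < size L) (L`_i).[n%:R] * f (n + i)%N.

Definition annihilates (L : ore) (f : nat -> rat) : Prop :=
  forall n, ore_act L f n = 0.

Definition summation_lift_of (L M : ore) : Prop :=
  L = (4^-1)%:P *: ore_sigma (ore_mul M (ore_S - 1)).

Definition partial_sums (f : nat -> rat) : nat -> rat :=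
  fun n => \sum_(k < n.+1) f k.

Definition L2_1 : ore :=
  let n := ore_n in
  ((n + 1) ^+ 4) *: 1
  - (n * (2 * n + 3) * (2 * n ^+ 2 + 6 * n + 5)) *: 'X
  + (4 * n * (n + 1) * (n + 2) ^+ 2) *: 'X^2.

Definition L3_pi_1 : ore :=
  let n := ore_n in
  - (4^-1 *: (n + 2) ^+ 4) *: 1
  + (4^-1 *: (5 * n ^+ 4 + 42 * n ^+ 3 + 130 * n ^+ 2 + 173 * n + 81)) *: 'X
  - (4^-1 *: ((n + 1) * (8 * n ^+ 3 + 62 * n ^+ 2 + 160 * n + 137))) *: 'X^2
  + ((n + 1) * (n + 2) * (n + 3) ^+ 2) *: 'X^3.

(* Main.v *)
Require Import Defs.
From mathcomp Require Import all_boot all_order all_algebra.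
From mathcomp Require Import ring lra zify.

Set Implicit Arguments.
Unset Strict Implicit.
Unset Printing Implicit Defensive.

Import Order.TTheory GRing.Theory Num.Theory.
Local Open Scope ring_scope.

(** The sequence is determined by its recurrence and its value at [0], so the
closed form and the Clausen-type formula agree once both are shown to satisfy
that recurrence. Write [D = x d/dx].

For the convolution, [f = F(16 x)] has coefficients the squares of the central
binomial coefficients, and it solves [D^2 f = 4 x (2 D + 1)^2 f]. Hence
[y = f^2] and [u = (D f)^2] satisfy two linear differential equations without
further unknowns ([conv_euler_sq], [conv_euler_cross]). Eliminating [u] leaves
the third-order equation of the symmetric square, which is the recurrence when
read on coefficients ([conv_recurrence]). The Leibniz computations are done on
the coefficients, as sums of [a i * a j] weighted by polynomials in [i] and [j].

For the 3F2, the same third-order operator is [(1 - 32 x) / (1 - 16 x)] times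
the hypergeometric operator [T^3 - z (T + 1/2)^3], with [T = z d/dz], pulled
back along [z = 64 x (1 - 16 x)]. Since [(1 - 32 x) / (1 - 16 x) z^m] is
[D (z^m) / m], the operator maps the term [F32 m * z^m] of the series to
[m^2 F32 m D (z^m) - (m+1)^2 F32 (m+1) D (z^(m+1))], and the sum over [m]
telescopes ([clausen_telescope], [fps_comp_clausen_recurrence]).

In terms of [c], with [n A n = 32^n c n], the recurrence at [n + 2] becomes the
one of the operator [L2_1].
The lift acts on partial sums because [ore_mul] is composition of actions:
[S - 1] sends the sums of the first [n] terms of [f] back to [f], and [sigma]
accounts for the last term being included in [partial_sums]
([summation_lift_annihilates]). *)

(** * Hypergeometric coefficients and central binomial coefficients *)

Lemma hypergeometricS a b n :
  hypergeometric a b n.+1 =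
  (\prod_(u <- a) (u + n%:R)) / ((\prod_(v <- b) (v + n%:R)) * n.+1%:R) *
  hypergeometric a b n.
Proof.
have pochE (s : seq rat) : \prod_(u <- s) pochhammer u n.+1 =
    \prod_(u <- s) pochhammer u n * \prod_(u <- s) (u + n%:R).
  rewrite -big_split; apply: eq_bigr => u _.
  by rewrite /pochhammer big_ord_recr.
by rewrite /hypergeometric !pochE factS natrM !invfM; ring.
Qed.

Lemma fps_comp_scaleX f (z : rat) n : fps_comp f (z *: 'X) n = f n * z ^+ n.
Proof.
rewrite /fps_comp big_ord_recr big1 /= => [|i _].
  by rewrite add0r exprZn coefZ coefXn eqxx mulr1.
by rewrite exprZn coefZ coefXn gtn_eqF ?mulr0.
Qed.

Lemma central_binomialS n :
  (n.+1 * 'C(2 * n.+1, n.+1) = 2 * (2 * n + 1) * 'C(2 * n, n))%N.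
Proof.
have e1 : ((2 * n).+1 - n = n.+1)%N by lia.
have /= := mul_bin_down (2 * n).+1 n; rewrite e1 -mulnA addn1 => ->.
have -> : (2 * n.+1 = (2 * n).+2)%N by rewrite mulnS.
by rewrite -mul_bin_diag /= mulnA mulnS.
Qed.

Lemma F21_16 n : fps_comp F21 (16 *: 'X) n = ('C(2 * n, n) ^ 2)%:R.
Proof.
rewrite fps_comp_scaleX; elim: n => [|n IHn].
  rewrite /F21 /hypergeometric !big_cons !big_nil.
  by rewrite /pochhammer !big_ord0 fact0.
have n1 : n.+1%:R ^+ 2 != 0 :> rat by rewrite expf_neq0 ?pnatr_eq0.
apply: (mulfI n1).
rewrite -natrX -natrM -expnMn central_binomialS expnMn natrM -IHn.
rewrite /F21 hypergeometricS !big_cons !big_nil exprS.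
have {}n1 : n%:R + 1 != 0 :> rat by rewrite natr1 pnatr_eq0.
rewrite !natrX !natrM natrD natrM -natr1.
by field.
Qed.

Lemma central_binomial_sq_rec n :
  n.+1%:R ^+ 2 * ('C(2 * n.+1, n.+1) ^ 2)%:R =
  4 * (2 * n%:R + 1) ^+ 2 * ('C(2 * n, n) ^ 2)%:R :> rat.
Proof.
rewrite -natrX -natrM -expnMn central_binomialS expnMn natrM.
by congr (_ * _); rewrite natrX !natrM natrD natrM; ring.
Qed.

(** * The recurrence characterizing the sequence *)

Definition A036917_recurrence (y : nat -> rat) :=
  forall n : nat, (1 <= n)%N ->
  n%:R ^+ 3 * y n =
    8 * (2 * n%:R - 1) * (2 * n%:R ^+ 2 - 2 * n%:R + 1) * y n.-1
    - 256 * (n%:R - 1) ^+ 3 * y n.-2.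

Lemma A036917_recurrence_unique y z :
  A036917_recurrence y -> A036917_recurrence z -> y 0 = z 0 -> y =1 z.
Proof.
move=> hy hz e0 n.
(* A second-order recurrence needs two consecutive values; at n = 0 both of
   them are the value at 0, because 0.-1 = 0. *)
suff [] : y n = z n /\ y n.-1 = z n.-1 by [].
elim: n => [//|n [en en1]] /=; split=> //.
have n0 : n.+1%:R ^+ 3 != 0 :> rat by rewrite expf_neq0 // pnatr_eq0.
apply: (mulfI n0); rewrite (hy n.+1 isT) (hz n.+1 isT) -[n.+1.-1]/n.
by rewrite -[n.+1.-2]/n.-1 en en1.
Qed.

(** * The convolution square *)

Section WeightedConvolution.
Variable a : nat -> rat.

(** If [f] has coefficients [a], the weight [i ^ r * j ^ s] gives the
coefficients of [D^r f * D^s f], where [D = x d/dx]. *)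
Definition wconv (phi : rat -> rat -> rat) n :=
  \sum_(i < n.+1) phi i%:R (n - i)%:R * (a i * a (n - i)%N).

Lemma wconvD phi psi n :
  wconv (fun x y => phi x y + psi x y) n = wconv phi n + wconv psi n.
Proof. by rewrite -big_split; apply: eq_bigr => i _ /=; rewrite mulrDl. Qed.

Lemma wconvZ s phi n : wconv (fun x y => s * phi x y) n = s * wconv phi n.
Proof. by rewrite /wconv mulr_sumr; apply: eq_bigr => i _; rewrite -mulrA. Qed.

Lemma wconv_swap phi n : wconv (fun x y => phi y x) n = wconv phi n.
Proof.
rewrite /wconv (reindex_inj rev_ord_inj); apply: eq_bigr => i _ /=.
have le_in : (i <= n)%N by rewrite -ltnS.
by rewrite subSS subKn // [a i * _]mulrC.
Qed.

(** Both factors of the convolution are the same series, so only the symmetric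
part of the weight counts, and only on the line [x + y = n]. This reduces every
linear relation between weighted convolutions to a polynomial identity. *)
Lemma eq_wconv_sym phi psi n :
    (forall x y, x + y = n%:R -> phi x y + phi y x = psi x y + psi y x) ->
  wconv phi n = wconv psi n.
Proof.
move=> eq_sym; suff: 2 * wconv phi n = 2 * wconv psi n.
  by apply: mulfI; rewrite pnatr_eq0.
have dbl chi : 2 * wconv chi n = wconv (fun x y => chi x y + chi y x) n.
  by rewrite wconvD wconv_swap; ring.
rewrite !dbl; apply: eq_bigr => i _; rewrite eq_sym //.
by rewrite -natrD subnKC // -ltnS.
Qed.

Hypothesis a_rec :
  forall i, i.+1%:R ^+ 2 * a i.+1 = 4 * (2 * i%:R + 1) ^+ 2 * a i.

(** The differential equation [D^2 f = 4 x (2 D + 1)^2 f] applied to the first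
factor; multiplication by [x] is what lowers the index. *)
Lemma wconv_step phi n :
  wconv (fun x y => x ^+ 2 * phi x y) n.+1 =
  wconv (fun x y => 4 * (2 * x + 1) ^+ 2 * phi (x + 1) y) n.
Proof.
rewrite /wconv big_ord_recl /= expr0n !mul0r add0r; apply: eq_bigr => i _.
rewrite /bump /= add1n subSS -natr1.
transitivity (phi (i%:R + 1) (n - i)%:R * a (n - i)%N * (i.+1%:R ^+ 2 * a i.+1)).
  by rewrite -natr1; ring.
by rewrite a_rec; ring.
Qed.

(* The coefficients of f^2 and of (D f)^2. *)
Local Notation y := (wconv (fun _ _ => 1)).
Local Notation u := (wconv (fun i j => i * j)).

(** From [D^2 (f^2) = 2 f D^2 f + 2 (D f)^2]: once [D^2 f] is replaced, the
term [x f D^2 f] is traded back for [x D^2 (f^2)] and [x (D f)^2]. *)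
Lemma conv_euler_sq n :
  n.+1%:R ^+ 2 * y n.+1 =
  8 * (2 * n%:R ^+ 2 + 2 * n%:R + 1) * y n + 2 * (u n.+1 - 16 * u n).
Proof.
have -> : n.+1%:R ^+ 2 * y n.+1 =
    2 * wconv (fun i j => i ^+ 2 * 1) n.+1 + 2 * u n.+1.
  rewrite -!wconvZ -wconvD; apply: eq_wconv_sym => i j <-; ring.
rewrite wconv_step.
suff -> : wconv (fun i j => 4 * (2 * i + 1) ^+ 2 * 1) n =
    4 * (2 * n%:R ^+ 2 + 2 * n%:R + 1) * y n + - 16 * u n by ring.
by rewrite -!wconvZ -wconvD; apply: eq_wconv_sym => i j <-; ring.
Qed.

(** From [D ((D f)^2) = 2 D f D^2 f]. *)
Lemma conv_euler_cross n :
  n.+1%:R * u n.+1 = 16 * (n%:R + 2) * u n + 4 * n%:R * y n.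
Proof.
have -> : n.+1%:R * u n.+1 = 2 * wconv (fun i j => i ^+ 2 * j) n.+1.
  by rewrite -!wconvZ; apply: eq_wconv_sym => i j <-; ring.
rewrite wconv_step -!wconvZ -wconvD; apply: eq_wconv_sym => i j <-; ring.
Qed.

Lemma conv_recurrence : A036917_recurrence y.
Proof.
(* Multiplying the first relation by n + 1 and using the second one leaves a
   single u; two consecutive instances are then compatible with the first
   relation only if y satisfies a recurrence. *)
have elim_u n : 32 * u n = n.+1%:R ^+ 3 * y n.+1 -
    (8 * n.+1%:R * (2 * n%:R ^+ 2 + 2 * n%:R + 1) + 8 * n%:R) * y n.
  transitivity (n.+1%:R * (n.+1%:R ^+ 2 * y n.+1) -
    (8 * n.+1%:R * (2 * n%:R ^+ 2 + 2 * n%:R + 1) + 8 * n%:R) * y n); last by ring.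
  rewrite conv_euler_sq; have := conv_euler_cross n; rewrite -natr1 => h.
  lra.
case=> [//|[|n]] _.
  (* u 0 = 0, its only term having weight 0. *)
  have := elim_u 0%N; rewrite {1}/wconv big_ord1 /= => h.
  lra.
have h0 := elim_u n; have h1 := elim_u n.+1; have h2 := conv_euler_sq n.
move: h0 h1 h2; rewrite -!natr1 => h0 h1 h2.
lra.
Qed.

End WeightedConvolution.

(** * The pullback of the hypergeometric series *)

Definition clausen_arg : {poly rat} := 64 *: ('X * (1 - 16 *: 'X)).

Local Notation p m n := ((clausen_arg ^+ m)`_n).

Lemma coef_clausen_arg_lt m n : (n < m)%N -> p m n = 0.
Proof. by move=> lt_nm; rewrite exprZn coefZ exprMn coefXnM lt_nm mulr0. Qed.

Lemma deriv_clausen_arg : clausen_arg^`() = 64 *: (1 - 32 *: 'X).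
Proof.
rewrite /clausen_arg derivZ derivM derivB derivX derivZ derivX derivC.
by congr (_ *: _); rewrite -!mul_polyC; ring.
Qed.

Lemma coef_XmulDeriv (q : {poly rat}) n : ('X * q^`())`_n = n%:R * q`_n.
Proof.
by case: n => [|n]; rewrite coefXM ?mul0r //= coef_deriv mulr_natl.
Qed.

(** The derivative of a power, with [z' = 64 (1 - 32 x)]. *)
Lemma coef_clausen_argS m n :
  n.+2%:R * p m.+1 n.+2 = 64 * m.+1%:R * (p m n.+1 - 32 * p m n).
Proof.
rewrite mulr_natl -coef_deriv deriv_exp /= deriv_clausen_arg.
have -> : 64 *: (1 - 32 *: 'X) * clausen_arg ^+ m *+ m.+1 =
    (64 * m.+1%:R) *: (clausen_arg ^+ m - 32 *: ('X * clausen_arg ^+ m)).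
  by rewrite -!mul_polyC polyCM; ring.
by rewrite coefZ coefB coefZ coefXM.
Qed.

(** The powers of [z] solve the first-order equation
[x (1 - 16 x) q' = m (1 - 32 x) q], which follows from
[x (1 - 16 x) z' = (1 - 32 x) z]. *)
Lemma coef_clausen_arg_rec m n :
  (n.+1%:R - m%:R) * p m n.+1 = - 16 * (2 * m%:R - n%:R) * p m n.
Proof.
set q := clausen_arg ^+ m.
have eqD : 'X * q^`() - 16 *: ('X * ('X * q^`())) = m%:R *: (q - 32 *: ('X * q)).
  rewrite /q; case: m {q} => [|m].
    by rewrite expr0 derivC !mulr0 scaler0 subr0 scale0r.
  rewrite deriv_exp deriv_clausen_arg exprS -[m.+1.-1]/m.
  move: (clausen_arg ^+ m) => r; rewrite /clausen_arg -!mul_polyC -mulr_natr.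
  ring.
have := congr1 (fun r : {poly rat} => r`_n.+1) eqD.
rewrite /= coefB coefZ coef_XmulDeriv [in X in _ - X]coefXM /= coef_XmulDeriv.
rewrite coefZ coefB coefZ coefXM /=.
by move=> h; lra.
Qed.

Lemma F32_rec m : m.+1%:R ^+ 3 * F32 m.+1 = (m%:R + 1 / 2) ^+ 3 * F32 m.
Proof.
rewrite /F32 hypergeometricS !big_cons !big_nil -natr1.
have m1 : m%:R + 1 != 0 :> rat by rewrite natr1 pnatr_eq0.
by field.
Qed.

(** The third-order operator applied to one term of the series is a difference
in [m]: it is the pullback of the hypergeometric operator, which sends [z^m] to
[m^3 z^m - (m + 1/2)^3 z^(m+1)], and [F32_rec] turns the second term into the
first one at [m + 1]. The factor [n + 2] is the action of [x d/dx]. *)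
Lemma clausen_telescope m n :
  F32 m * (n.+2%:R ^+ 3 * p m n.+2
    - 8 * (2 * n.+2%:R - 1) * (2 * n.+2%:R ^+ 2 - 2 * n.+2%:R + 1) * p m n.+1
    + 256 * (n.+2%:R - 1) ^+ 3 * p m n) =
  n.+2%:R * m%:R ^+ 2 * F32 m * p m n.+2
  - n.+2%:R * m.+1%:R ^+ 2 * F32 m.+1 * p m.+1 n.+2.
Proof.
have m1 : m.+1%:R != 0 :> rat by rewrite pnatr_eq0.
have -> : n.+2%:R * m.+1%:R ^+ 2 * F32 m.+1 * p m.+1 n.+2 =
    64 * (m%:R + 1 / 2) ^+ 3 * F32 m * (p m n.+1 - 32 * p m n).
  apply: (mulfI m1).
  transitivity (m.+1%:R ^+ 3 * F32 m.+1 * (n.+2%:R * p m.+1 n.+2)); first by ring.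
  by rewrite F32_rec coef_clausen_argS; ring.
have r1 := coef_clausen_arg_rec m n.+1.
have r0 := coef_clausen_arg_rec m n.
have natS k : k.+1%:R = k%:R + 1 :> rat by rewrite natr1.
rewrite (natS n.+1) (natS n) in r0 r1 *.
(* The coefficient of p m n.+2 is (n+2)^3 - (n+2) m^2, a multiple of n+2 - m.
   After r1 has removed this term, the coefficient of p m n.+1 is divisible by
   n+1 - m, and the multiplier of r0 is the quotient. *)
have {}r1 := congr1 (fun t => F32 m * (n%:R + 2) * (n%:R + 2 + m%:R) * t) r1.
have {}r0 := congr1 (fun t => - 16 * F32 m * (4 * m%:R ^+ 2 +
  2 * (n%:R + 3) * m%:R + (n%:R + 2) ^+ 2 - (n%:R + 1)) * t) r0.
cbv beta in r0, r1.
lra.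
Qed.

(** The truncation of the composition depends on [n]; a common range of
summation is needed to combine three consecutive coefficients. *)
Lemma fps_comp_clausen_widen n N : (n <= N)%N ->
  fps_comp F32 clausen_arg n = \sum_(m < N.+1) F32 m * p m n.
Proof.
move=> le_nN; rewrite /fps_comp.
rewrite (big_ord_widen N.+1 (fun m => F32 m * p m n)) // big_mkcond.
apply: eq_bigr => m _; case: ifPn => //; rewrite -leqNgt => lt_nm.
by rewrite coef_clausen_arg_lt // mulr0.
Qed.

Lemma fps_comp_clausen0 : fps_comp F32 clausen_arg 0 = 1.
Proof.
rewrite /fps_comp big_ord1 expr0 coef1 /F32 /hypergeometric !big_cons !big_nil.
by rewrite /pochhammer !big_ord0 fact0.
Qed.

Lemma fps_comp_clausen_recurrence :
  A036917_recurrence (fps_comp F32 clausen_arg).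
Proof.
case=> [//|[|n]] _.
  have -> : fps_comp F32 clausen_arg 1 = 8.
    have F32_1 : F32 1 = 1 / 8.
      have := F32_rec 0; have -> : F32 0 = 1.
        by have := fps_comp_clausen0; rewrite /fps_comp big_ord1 expr0 coef1 mulr1.
      by rewrite expr1n mul1r => ->; field.
    rewrite /fps_comp big_ord_recl big_ord1 expr0 coef1 mulr0 add0r expr1 F32_1.
    rewrite coefZ coefXM -[1.-1]/0%N coefB coef1 coefZ coefX mulr0 subr0 /=.
    by field.
  rewrite -[1.-1]/0%N fps_comp_clausen0; lra.
rewrite -[n.+2.-1]/n.+1 -[n.+2.-2]/n.
rewrite !(@fps_comp_clausen_widen _ n.+2) //; last exact: leqW.
(* G 0 vanishes by its factor m, and G n.+3 because z^m is divisible by x^m. *)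
pose G m := n.+2%:R * m%:R ^+ 2 * F32 m * p m n.+2.
have tele : \sum_(m < n.+3) (G m.+1 - G m) = 0.
  rewrite -(big_mkord xpredT (fun m => G m.+1 - G m)) telescope_sumr // /G.
  by rewrite (coef_clausen_arg_lt (ltnSn _)) mulr0 expr0n mulr0 !mul0r subr0.
apply: subr0_eq; rewrite -[RHS]oppr0 -[in RHS]tele -[RHS]sumrN.
rewrite !mulr_sumr -!sumrB; apply: eq_bigr => m _.
have e := clausen_telescope m n; rewrite /G; lra.
Qed.

(** * The Ore algebra and summation lifts *)

(** The coefficients of [S - 1] are constants, which commute with [S]; in this
case the product of the Ore algebra is the commutative one. *)
Lemma ore_mul_S1 (L : ore) : ore_mul L (ore_S - 1) = L * ('X - 1).
Proof.
have sz : size (ore_S - 1 : ore) = 2 by rewrite size_XsubC.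
have iter_shiftC i (x : rat) : iter i shift_poly x%:P = x%:P.
  by elim: i => //= i ->; rewrite /shift_poly comp_polyC.
rewrite /ore_mul sz -[in RHS](coefK L) poly_def mulr_suml; apply: eq_bigr => i _.
rewrite big_ord_recl big_ord1 /= !coefB !coefX !coefC /= sub0r subr0 -polyCN.
rewrite !iter_shiftC addn0 addn1 exprSr -!mul_polyC !polyCM !polyCN !polyC1; ring.
Qed.

Lemma iter_shift_poly_horner i (q : {poly rat}) (x : rat) :
  (iter i shift_poly q).[x] = q.[x + i%:R].
Proof.
elim: i x => [|i IHi] x /=; first by rewrite addr0.
rewrite /shift_poly horner_comp IHi !hornerE -natr1; congr (_.[_]); ring.
Qed.

Lemma ore_act_widen (L : ore) f n N : (size L <= N)%N ->
  ore_act L f n = \sum_(i < N) (L`_i).[n%:R] * f (n + i)%N.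
Proof.
move=> le_LN; rewrite /ore_act.
rewrite (big_ord_widen N (fun i => (L`_i).[n%:R] * f (n + i)%N)) // big_mkcond.
apply: eq_bigr => i _; case: ifPn => //; rewrite -leqNgt => le_Li.
by rewrite nth_default // horner0 mul0r.
Qed.

Lemma eq_ore_act (L : ore) f g n : f =1 g -> ore_act L f n = ore_act L g n.
Proof. by move=> eq_fg; apply: eq_bigr => i _; rewrite eq_fg. Qed.

Lemma ore_actD (L M : ore) f n :
  ore_act (L + M) f n = ore_act L f n + ore_act M f n.
Proof.
set N := maxn (size L) (size M).
rewrite !(@ore_act_widen _ _ _ N) ?leq_maxl ?leq_maxr ?size_polyD // -big_split.
by apply: eq_bigr => i _; rewrite coefD hornerD mulrDl.
Qed.

Lemma ore_actZ (x : rat) (L : ore) f n :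
  ore_act (x%:P *: L) f n = x * ore_act L f n.
Proof.
rewrite (@ore_act_widen _ _ _ (size L)) ?size_scale_leq // mulr_sumr.
by apply: eq_bigr => i _; rewrite coefZ hornerM hornerC mulrA.
Qed.

Lemma ore_act_sum (I : Type) (r : seq I) (F : I -> ore) f n :
  ore_act (\sum_(i <- r) F i) f n = \sum_(i <- r) ore_act (F i) f n.
Proof.
apply: (big_morph (fun L => ore_act L f n)) => [L M|]; first exact: ore_actD.
by rewrite /ore_act size_poly0 big_ord0.
Qed.

Lemma ore_act_monomial (q : {poly rat}) k f n :
  ore_act (q *: 'X^k) f n = q.[n%:R] * f (n + k)%N.
Proof.
rewrite (@ore_act_widen _ _ _ k.+1); last first.
  by rewrite (leq_trans (size_scale_leq _ _)) ?size_polyXn.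
rewrite big_ord_recr big1 /= => [|i _].
  by rewrite add0r coefZ coefXn eqxx mulr1.
by rewrite coefZ coefXn ltn_eqF // mulr0 horner0 mul0r.
Qed.

(** The commutation rule of the Ore algebra is the one making sequences a left
module. *)
Lemma ore_act_mul (L M : ore) f :
  ore_act (ore_mul L M) f =1 ore_act L (ore_act M f).
Proof.
move=> n; rewrite /ore_mul ore_act_sum; apply: eq_bigr => i _.
rewrite ore_act_sum mulr_sumr; apply: eq_bigr => j _.
by rewrite ore_act_monomial hornerM iter_shift_poly_horner natrD addnA mulrA.
Qed.

Lemma shift_poly_horner (q : {poly rat}) (x : rat) :
  (shift_poly q).[x] = q.[x + 1].
Proof. exact: (iter_shift_poly_horner 1). Qed.

(** As operators on sequences, [sigma L] is [L] conjugated by the shift. *)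
Lemma ore_act_sigma (L : ore) f n :
  ore_act (ore_sigma L) (fun k => f k.+1) n = ore_act L f n.+1.
Proof.
rewrite (@ore_act_widen _ _ _ (size L)) ?size_poly //; apply: eq_bigr => i _.
rewrite coef_map_id0; last by rewrite /shift_poly comp_poly0.
by rewrite shift_poly_horner natr1 addSn.
Qed.

Lemma summation_lift_annihilates (L M : ore) f :
  summation_lift_of L M -> annihilates M f -> annihilates L (partial_sums f).
Proof.
move=> -> Mf n.
(* Unlike partial_sums f, s starts with the empty sum, so that its difference
   is f itself; the shift of s is partial_sums f. *)
pose s n := \sum_(k < n) f k.
have S1s : ore_act (ore_S - 1) s =1 f.
  move=> k; rewrite (@ore_act_widen _ _ _ 2) ?size_XsubC //.
  rewrite big_ord_recl big_ord1 /= !coefB !coefX !coefC /= sub0r subr0.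
  by rewrite hornerN hornerC addn0 addn1 /s big_ord_recr /=; ring.
rewrite ore_actZ -[partial_sums f]/(fun k => s k.+1) ore_act_sigma ore_act_mul.
by rewrite (eq_ore_act _ _ S1s) Mf mulr0.
Qed.

Lemma L3_pi_1_lift : summation_lift_of L3_pi_1 L2_1.
Proof.
rewrite /summation_lift_of ore_mul_S1 /ore_sigma -[shift_poly]/(comp_poly ('X + 1)).
rewrite /L3_pi_1 /L2_1 /ore_S /ore_n rmorphM rmorphB rmorph1 rmorphD rmorphB.
rewrite /= !map_polyZ !map_polyX rmorph1 map_polyXn.
rewrite !(rmorphM, rmorphXn, rmorphD, rmorph_nat) /= !comp_polyX !rmorph1.
(* The leading coefficient is stated without the factor 1/4 of the others; with
   1/4 in front of every term, the identity holds for an arbitrary e. *)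
pose e : {poly rat} := (4^-1)%:P.
have e4 : e * 4 = 1 by rewrite -(polyC_natr rat 4) -polyCM mulVf.
have -> : ('X + 1) * ('X + 2) * ('X + 3) ^+ 2 =
  e * (4 * (('X + 1) * ('X + 2) * ('X + 3) ^+ 2)) by rewrite [RHS]mulrA e4 mul1r.
rewrite -!(mul_polyC 4^-1) -/e -!mul_polyC.
ring.
Qed.

Lemma ore_act_L2_1 f n :
  ore_act L2_1 f n =
  (n%:R + 1) ^+ 4 * f n
  - n%:R * (2 * n%:R + 3) * (2 * n%:R ^+ 2 + 6 * n%:R + 5) * f n.+1
  + 4 * n%:R * (n%:R + 1) * (n%:R + 2) ^+ 2 * f n.+2.
Proof.
(* The three terms are put in the form of monomials, with 1 as 'X^0. *)
have -> : L2_1 = ('X + 1) ^+ 4 *: 'X^0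
    + (- ('X * (2 * 'X + 3) * (2 * 'X ^+ 2 + 6 * 'X + 5))) *: 'X^1
    + (4 * 'X * ('X + 1) * ('X + 2) ^+ 2) *: 'X^2 by rewrite scaleNr.
rewrite 2!ore_actD 3!ore_act_monomial addn0 addn1 addn2.
rewrite hornerN !(hornerM, horner_exp, hornerD, hornerX) !hornerC; ring.
Qed.

(** * Binomial sum, Clausen formula and summation lift *)

Theorem theorem4p1 (A c : nat -> rat)
    (hA : forall n, A n = fps_mul (fps_comp F21 (16 *: 'X))
                                  (fps_comp F21 (16 *: 'X)) n)
    (hc : forall n, c n = n%:R * A n / 32 ^+ n) :
  [/\ (* (a) *)
      (forall n, A n = (A036917 n)%:R)
      (* at n = 1 the last term has coefficient 0, whatever n.-2 is *)
      /\ (forall n : nat, (1 <= n)%N ->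
            n%:R ^+ 3 * A n =
              8 * (2 * n%:R - 1) * (2 * n%:R ^+ 2 - 2 * n%:R + 1) * A n.-1
              - 256 * (n%:R - 1) ^+ 3 * A n.-2),
      (* (b) *)
      (forall n, A n = fps_comp F32 (64 *: ('X * (1 - 16 *: 'X))) n)
    & (* (c) *)
      [/\ annihilates L2_1 c,
          (forall n : nat,
             (n%:R + 1) ^+ 4 * c n
             - n%:R * (2 * n%:R + 3) * (2 * n%:R ^+ 2 + 6 * n%:R + 5) * c n.+1
             + 4 * n%:R * (n%:R + 1) * (n%:R + 2) ^+ 2 * c n.+2 = 0),
          summation_lift_of L3_pi_1 L2_1
        & (forall f : nat -> rat,
             annihilates L2_1 f -> annihilates L3_pi_1 (partial_sums f))]].
Proof.
pose a n : rat := ('C(2 * n, n) ^ 2)%:R.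
have A_conv n : A n = wconv a (fun _ _ => 1) n.
  by rewrite hA; apply: eq_bigr => k _; rewrite !F21_16 mul1r.
have A_binom n : A n = (A036917 n)%:R.
  rewrite A_conv /A036917 natr_sum; apply: eq_bigr => k _.
  by rewrite mul1r -mulnBr natrM.
have A_rec : A036917_recurrence A.
  move=> n n_gt0; rewrite !A_conv.
  exact: (conv_recurrence central_binomial_sq_rec).
have A_clausen : A =1 fps_comp F32 clausen_arg.
  apply: A036917_recurrence_unique A_rec fps_comp_clausen_recurrence _.
  by rewrite fps_comp_clausen0 A_binom /A036917 big_ord1.
have c_rec (n : nat) : (n%:R + 1) ^+ 4 * c n
    - n%:R * (2 * n%:R + 3) * (2 * n%:R ^+ 2 + 6 * n%:R + 5) * c n.+1
    + 4 * n%:R * (n%:R + 1) * (n%:R + 2) ^+ 2 * c n.+2 = 0.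
  have natS k : k.+1%:R = k%:R + 1 :> rat by rewrite natr1.
  rewrite !hc !(exprS 32) !invfM.
  have := A_rec n.+2 isT; rewrite -[n.+2.-1]/n.+1 -[n.+2.-2]/n.
  rewrite (natS n.+1) (natS n) => e.
  (* Since k A k = 32^k c k, this factor turns the term (n+2)^3 A n.+2 into
     4 n (n+1) (n+2)^2 c n.+2. *)
  have {}e := congr1 (fun t => n%:R * (n%:R + 1) / 256 / 32 ^+ n * t) e.
  cbv beta in e; lra.
split; [by split | exact: A_clausen | split].
- by move=> n; rewrite ore_act_L2_1.
- exact: c_rec.
- exact: L3_pi_1_lift.
- by move=> f; apply: summation_lift_annihilates L3_pi_1_lift.
Qed.
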